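(* For every $n\ge 2$, the path $P_n$ on $n$ vertices satisfies $\chi_c^\star(P_n)=2$. For every $n\ge 3$, the cycle $C_n$ on $n$ vertices satisfies $\chi_c^\star(C_n)=4$.
   Context: A correspondence-cover of a graph $G$ is a pair $(L,H)$ where $H$ is a graph and $L:V(G)\to 2^{V(H)}$ is such that: the sets $L(v)$ partition $V(H)$; for distinct non-adjacent $u,v$ there are no edges of $H$ between $L(u)$ and $L(v)$; for $uv\in E(G)$ the edges of $H$ between $L(u)$ and $L(v)$ form a matching; each $L(v)$ induces a clique in $H$. It is $k$-fold if $|L(v)|=k$ for all $v$. The correspondence packing number $\chi_c^\star(G)$ is the least $k$ such that every $k$-fold correspondence-cover $(L,H)$ of $G$ satisfies $\chi(H)=k$. *)

(* Defs.v *)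
From HB Require Import structures.
From mathcomp Require Import all_boot.
Set Implicit Arguments.
Unset Strict Implicit.
Unset Printing Implicit Defensive.

Record sgraph := SGraph {
  vertex :> finType;
  edge : rel vertex;
  edge_sym : symmetric edge;
  edge_irrefl : irreflexive edge }.

Section Chromatic.
Variable H : sgraph.

Definition proper_coloring (k : nat) (c : {ffun H -> 'I_k}) : bool :=
  [forall x, forall y, edge x y ==> (c x != c y)].

Definition colorable (k : nat) : bool :=
  [exists c : {ffun H -> 'I_k}, proper_coloring c].

Lemma colorable_card : exists k, colorable k.
Proof.
exists #|H|; apply/existsP; exists [ffun x => enum_rank x].
apply/forallP => x; apply/forallP => y; apply/implyP => xy.
rewrite !ffunE (inj_eq enum_rank_inj).
by apply: contraTneq xy => ->; rewrite edge_irrefl.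
Qed.

Definition chromatic_number : nat := ex_minn colorable_card.
End Chromatic.

(* The matching condition is stated in one direction only: applying it to
   both (u, v) and (v, u) bounds the degrees on both sides. *)
Record correspondence_cover (G H : sgraph) (L : G -> {set H}) : Prop := {
  cover_partition : forall x : H, exists! v : G, x \in L v;
  cover_nonadjacent : forall u v : G, u != v -> ~~ edge u v ->
    forall x y : H, x \in L u -> y \in L v -> ~~ edge x y;
  cover_matching : forall u v : G, edge u v ->
    forall x y z : H, x \in L u -> y \in L v -> z \in L v ->
    edge x y -> edge x z -> y = z;
  cover_clique : forall (v : G) (x y : H),
    x \in L v -> y \in L v -> x != y -> edge x y }.

Definition k_fold (G H : sgraph) (L : G -> {set H}) (k : nat) : Prop :=
  forall v : G, #|L v| = k.

Definition correspondence_packable (G : sgraph) (k : nat) : Prop :=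
  forall (H : sgraph) (L : G -> {set H}),
    correspondence_cover L -> k_fold L k -> chromatic_number H = k.

(* [k] is the correspondence packing number of [G]. The minimum ranges over
   positive integers: a 0-fold cover has an empty graph H, so that
   [correspondence_packable G 0] always holds. *)
Definition is_correspondence_packing_number (G : sgraph) (k : nat) : Prop :=
  [/\ 0 < k, correspondence_packable G k &
      forall j : nat, 0 < j -> correspondence_packable G j -> k <= j].

Section PathCycle.
Variable n : nat.

Definition path_edge : rel 'I_n :=
  fun i j => (i.+1 == j :> nat) || (j.+1 == i :> nat).

Lemma path_edge_sym : symmetric path_edge.
Proof. by move=> i j; rewrite /path_edge orbC. Qed.

Lemma path_edge_irrefl : irreflexive path_edge.
Proof. by move=> i; rewrite /path_edge orbb gtn_eqF. Qed.

Definition path_graph : sgraph := SGraph path_edge_sym path_edge_irrefl.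

(* The conjunct [i != j] only matters when n = 1. *)
Definition cycle_edge : rel 'I_n :=
  fun i j => (i != j) && ((i.+1 %% n == j :> nat) || (j.+1 %% n == i :> nat)).

Lemma cycle_edge_sym : symmetric cycle_edge.
Proof. by move=> i j; rewrite /cycle_edge eq_sym orbC. Qed.

Lemma cycle_edge_irrefl : irreflexive cycle_edge.
Proof. by move=> i; rewrite /cycle_edge eqxx. Qed.

Definition cycle_graph : sgraph := SGraph cycle_edge_sym cycle_edge_irrefl.
End PathCycle.

(* Main.v *)
(* Colour the vertices of G one at a time: a vertex with at most d earlier
   neighbours sees at most d forbidden colours at each element of its list, and
   each colour is forbidden at most d times, so 2d colours can be assigned
   bijectively. Paths have d = 1 and cycles d = 2. For k = 2 and k = 3 all
   derangements of k points have the same sign, so the sign of a k-colouring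
   read around a cycle is forced, and a closing matching of the wrong sign
   gives a cover without packing. *)
Require Import Defs.
From mathcomp Require Import all_boot all_fingroup.

Set Implicit Arguments.
Unset Strict Implicit.
Unset Printing Implicit Defensive.

(** * Counting tools and bijections avoiding forbidden values *)

Lemma leq_card_rel (T U : finType) (A : {set T}) (B : {set U}) (R : T -> U -> Prop) :
  (forall a, a \in A -> exists2 b, b \in B & R a b) ->
  (forall a a' b, a \in A -> a' \in A -> R a b -> R a' b -> a = a') ->
  #|A| <= #|B|.
Proof.
move=> exR injR; have [a0 Aa0|A0] := pickP [in A]; last by rewrite eq_card0.
have [b0 _ _] := exR a0 Aa0.
have /fin_all_exists [f fP] : forall a, exists b, a \in A -> b \in B /\ R a b.
  move=> a; have [/exR [b Bb Rab]|] := boolP (a \in A); first by exists b.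
  by exists b0.
have injf : {in A &, injective f}.
  move=> a a' Aa Aa' eqf; apply: (injR a a' (f a)) => //.
    by case: (fP a Aa).
  by rewrite eqf; case: (fP a' Aa').
rewrite -(card_in_imset injf); apply/subset_leq_card/subsetP => b /imsetP[a Aa ->].
by case: (fP a Aa).
Qed.

Lemma ex_inj_ord (T : finType) (X : {set T}) (k : nat) :
  0 < k -> #|X| = k -> exists f : {ffun T -> 'I_k}, {in X &, injective f}.
Proof.
case: k => // k _ cardX.
exists [ffun x => inord (index x (enum X))] => x y Xx Xy; rewrite !ffunE.
have lt z : z \in X -> index z (enum X) < k.+1.
  by move=> Xz; rewrite -cardX cardE index_mem mem_enum.
move=> /(congr1 val) /=; rewrite !inordK ?lt // => eqi.
by apply: (index_inj x) eqi; rewrite mem_enum.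
Qed.

(* If [x] is bad for a bijection [f], the elements [y] with [(x, f y)] good and
   those with [(y, f x)] good form two sets of size at least [d] in
   [X :\ x], which has [2d - 1] elements: swapping the values at [x] and at a
   common element lowers the number of bad points. *)
Lemma ex_avoiding_bijection (T : finType) (X : {set T}) (d : nat)
    (bad : T -> 'I_(d + d) -> bool) :
  0 < d -> #|X| = d + d ->
  (forall x, x \in X -> #|[set a | bad x a]| <= d) ->
  (forall a, #|[set x in X | bad x a]| <= d) ->
  exists2 f : {ffun T -> 'I_(d + d)}, {in X &, injective f} &
    forall x, x \in X -> ~~ bad x (f x).
Proof.
move=> d_gt0 cardX badr badc.
have [f0 /dinjectiveP f0inj] := ex_inj_ord (ltn_addr d d_gt0) cardX.
pose Bad (f : {ffun T -> 'I_(d + d)}) := [set x in X | bad x (f x)].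
have [f /dinjectiveP finj fmin] :=
  @arg_minnP _ f0 (fun f => dinjectiveb f X) (fun f => #|Bad f|) f0inj.
exists f => // x Xx; apply/negP => badx.
pose A := [set y in X | ~~ bad x (f y)].
pose B := [set y in X | ~~ bad y (f x)].
have cardXD (P : pred T) : #|[set y in X | ~~ P y]| + #|[set y in X | P y]| = d + d.
  rewrite addnC -cardX -(cardsID [set y | P y] X); congr (_ + _); apply: eq_card => y.
    by rewrite !inE.
  by rewrite !inE andbC.
have cardA : d <= #|A|.
  rewrite -(leq_add2r #|[set y in X | bad x (f y)]|) cardXD leq_add2l.
  apply: leq_trans (badr x Xx).
  rewrite -(card_in_imset (f := f)); last first.
    by move=> y z; rewrite !inE => /andP[Xy _] /andP[Xz _]; apply: finj.
  apply/subset_leq_card/subsetP => a /imsetP[y].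
  by rewrite !inE => /andP[_ ?] ->.
have cardB : d <= #|B|.
  by rewrite -(leq_add2r #|[set y in X | bad y (f x)]|) cardXD leq_add2l.
have [y /setIP[Ay By]] : exists y, y \in A :&: B.
  apply/set0Pn; apply/negP => /eqP AB.
  have sub : A :|: B \subset X :\ x.
    by apply/subsetP => y; rewrite !inE => /orP[] /andP[-> nb]; rewrite andbT;
       apply: contraNneq nb => ->.
  have := subset_leq_card sub; have := cardsD1 x X.
  rewrite cardsU AB cards0 subn0 Xx cardX => cardXx le.
  by have := leq_trans (leq_add cardA cardB) le; rewrite cardXx ltnn.
have [Xy nxy] : y \in X /\ ~~ bad x (f y) by move: Ay; rewrite inE => /andP[].
have nyx : ~~ bad y (f x) by move: By; rewrite inE => /andP[].
pose g := [ffun z => f (tperm x y z)].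
have Xt z : z \in X -> tperm x y z \in X by case: tpermP => // ->.
have ginj : dinjectiveb g X.
  apply/dinjectiveP => z t Xz Xt'; rewrite !ffunE => /finj-/(_ (Xt _ Xz) (Xt _ Xt')).
  exact: perm_inj.
have := fmin g ginj; rewrite leqNgt => /negP; apply.
apply: proper_card; apply/properP; split; last first.
  by exists x; rewrite !inE ?Xx ?badx // ffunE tpermL (negbTE nxy) andbF.
apply/subsetP => z; rewrite !inE ffunE => /andP[-> /=].
by case: tpermP => [->|->|//]; rewrite ?(negbTE nxy) ?(negbTE nyx).
Qed.

(** * Upper bounds by greedy colouring along a vertex ordering *)

Lemma colorable_chromatic_number (H : sgraph) : colorable H (chromatic_number H).
Proof. by rewrite /chromatic_number; case: ex_minnP. Qed.

Lemma chromatic_number_min (H : sgraph) (k : nat) :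
  colorable H k -> chromatic_number H <= k.
Proof. by rewrite /chromatic_number; case: ex_minnP => m _ /(_ k). Qed.

Lemma clique_leq_chromatic_number (H : sgraph) (K : {set H}) :
  {in K &, forall x y, x != y -> edge x y} -> #|K| <= chromatic_number H.
Proof.
move=> Kclique; have /existsP[c /forallP cP] := colorable_chromatic_number H.
rewrite -(card_in_imset (f := c)); last first.
  move=> x y Kx Ky eqc; apply/eqP/negPn/negP => /(Kclique x y Kx Ky) xy.
  by have /forallP/(_ y)/implyP/(_ xy) := cP x; rewrite eqc eqxx.
by rewrite -[leqRHS]card_ord max_card.
Qed.

(** Whole lists are coloured in order of [rank]. The vertex [v0] supplies the lower bound: its list
    is a clique of size [d + d]. *)
Lemma degenerate_packable (G : sgraph) (v0 : G) (rank : G -> nat) (d : nat) :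
  0 < d -> injective rank ->
  (forall v, #|[set u | edge u v & rank u < rank v]| <= d) ->
  correspondence_packable G (d + d).
Proof.
move=> d_gt0 rank_inj back H L [part nadj match_ cliq] kfold.
have uniqL x u v : x \in L u -> x \in L v -> u = v.
  by have [w [_ wP]] := part x => /wP <- /wP <-.
apply/eqP; rewrite eqn_leq -{2}(kfold v0) clique_leq_chromatic_number ?andbT; last first.
  by move=> x y; apply: cliq.
apply: chromatic_number_min.
suff partial m : exists c : {ffun H -> 'I_(d + d)}, forall u v x y,
    x \in L u -> y \in L v -> rank u < m -> rank v < m -> edge x y -> c x != c y.
  have [c cP] := partial (\max_(v : G) rank v).+1.
  apply/existsP; exists c; apply/forallP => x; apply/forallP => y; apply/implyP.
  have [u [xu _]] := part x; have [v [yv _]] := part y.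
  by apply: cP xu yv _ _; rewrite ltnS leq_bigmax.
elim: m => [|m [c cP]].
  by exists [ffun=> Ordinal (ltn_addr d d_gt0)].
(* Ranks may have gaps. If no vertex has rank [m], the old colouring still serves; otherwise [w] is
   the only such vertex and only its list is recoloured. *)
have [w /eqP rw|norank] := pickP [pred v | rank v == m]; last first.
  exists c => u v x y xu yv; rewrite !ltnS (leq_eqVlt (rank u)) (leq_eqVlt (rank v)).
  by move: (norank u) (norank v) => /= -> ->; apply: cP xu yv.
pose N := [set u | edge u w & rank u < rank w].
pose bad y a := [exists u in N, exists x in L u, edge x y && (c x == a)].
have badP y a : reflect (exists2 u, u \in N & exists2 x, x \in L u & edge x y /\ c x = a) (bad y a).
  apply: (iffP exists_inP) => -[u Nu].
    by case/exists_inP => x xu /andP[xy /eqP ca]; exists u => //; exists x.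
  by case=> x xu [xy /eqP ca]; exists u => //; apply/exists_inP; exists x; rewrite // xy.
have [f finj fP] : exists2 f : {ffun H -> 'I_(d + d)}, {in L w &, injective f} &
    forall x, x \in L w -> ~~ bad x (f x).
  apply: ex_avoiding_bijection => // [y yw|a].
    (* Forbidden colours at [y] are charged to earlier neighbours [u]: by the matching, [y] has at
       most one neighbour in [L u]. *)
    apply: leq_trans (back w).
    apply: (@leq_card_rel _ _ _ _ (fun a u => u \in N /\ exists2 x, x \in L u & edge x y /\ c x = a)).
      by move=> a; rewrite inE => /badP[u Nu ?]; exists u.
    move=> a a' u _ _ [Nu [x xu [xy <-]]] [_ [x' x'u [x'y <-]]]; congr (c _).
    move: Nu; rewrite inE => /andP[uw _].
    by apply: (match_ w u) yw xu x'u _ _; rewrite edge_sym.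
  (* Points forbidding [a] are charged likewise: [a] occurs at most once on the clique [L u], and
     its holder has at most one neighbour in [L w]. *)
  apply: leq_trans (back w).
  apply: (@leq_card_rel _ _ _ _ (fun y u => u \in N /\ exists2 x, x \in L u & edge x y /\ c x = a)).
    by move=> y; rewrite inE => /andP[_ /badP[u Nu ?]]; exists u.
  move=> y y' u; rewrite !inE => /andP[yw _] /andP[y'w _].
  move=> [/andP[uw ru] [x xu [xy ca]]] [_ [x' x'u [x'y' ca']]].
  have exx' : x = x'.
    apply/eqP/negPn/negP => nx; move: ru; rewrite rw => ru.
    by have := cP u u x x' xu x'u ru ru (cliq _ _ _ xu x'u nx); rewrite ca ca' eqxx.
  by apply: (match_ u w uw x) => //; rewrite exx'.
have new u x y : x \in L u -> y \in L w -> rank u < m -> edge x y -> c x != f y.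
  move=> xu yw ru xy; have uw : u != w by apply: contraTneq ru => ->; rewrite rw ltnn.
  have Euw : edge u w by apply: contraLR xy => nuw; apply: nadj xu yw.
  apply: contraNneq (fP y yw) => cf; apply/badP; exists u; first by rewrite inE Euw rw.
  by exists x.
exists [ffun x => if x \in L w then f x else c x] => u v x y xu yv.
have rk z t : z \in L t -> z \notin L w -> rank t < m.+1 -> rank t < m.
  move=> zt nzw; rewrite ltnS leq_eqVlt => /orP[/eqP|//].
  by rewrite -rw => /rank_inj tw; rewrite -tw zt in nzw.
move=> ru rv xy; rewrite !ffunE.
have [xw|nxw] := boolP (x \in L w); have [yw|nyw] := boolP (y \in L w).
- apply: contraTneq xy => /finj -> //; by rewrite edge_irrefl.
- rewrite eq_sym; apply: (new _ _ _ yv xw); first exact: rk yv nyw rv.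
  by rewrite edge_sym.
- by apply: (new _ _ _ xu yw) => //; exact: rk xu nxw ru.
- by apply: (cP _ _ _ _ xu yv) => //; [exact: rk xu nxw ru|exact: rk yv nyw rv].
Qed.

(** * Covers whose matchings are permutations *)

Section PermutationCover.
Variables (G : sgraph) (k : nat) (s : G -> G -> 'S_k).
Hypothesis sV : forall u v, s v u = ((s u v)^-1)%g.

Definition perm_cover_edge : rel (G * 'I_k) := fun x y =>
  (x.1 == y.1) && (x.2 != y.2) || edge x.1 y.1 && (s x.1 y.1 x.2 == y.2).

Lemma perm_cover_edge_sym : symmetric perm_cover_edge.
Proof.
move=> [u i] [v j]; rewrite /perm_cover_edge /= eq_sym [i == j]eq_sym edge_sym.
by rewrite (sV v u) -(inj_eq (@perm_inj _ (s v u))) permKV [i == s v u j]eq_sym.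
Qed.

Lemma perm_cover_edge_irrefl : irreflexive perm_cover_edge.
Proof. by move=> [u i]; rewrite /perm_cover_edge /= !eqxx edge_irrefl. Qed.

Definition perm_cover : sgraph := SGraph perm_cover_edge_sym perm_cover_edge_irrefl.

Definition perm_cover_part (v : G) : {set perm_cover} := [set x | x.1 == v].

Lemma perm_coverP : correspondence_cover perm_cover_part.
Proof.
split.
- move=> [u i]; exists u; split; first by rewrite inE.
  by move=> v; rewrite inE => /eqP.
- move=> u v uv nE [a i] [b j]; rewrite !inE /= => /eqP-> /eqP->.
  by rewrite /edge /= /perm_cover_edge /= (negbTE uv) (negbTE nE).
- move=> u v uv [a i] [b j] [b' j']; rewrite !inE /= => /eqP-> /eqP-> /eqP->.
  have nuv : u == v = false by apply: contraTF uv => /eqP->; rewrite edge_irrefl.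
  rewrite /edge /= /perm_cover_edge /= nuv /=.
  by move=> /andP[_ /eqP<-] /andP[_ /eqP<-].
- move=> v [a i] [b j]; rewrite !inE /= => /eqP-> /eqP-> nij.
  rewrite /edge /= /perm_cover_edge /= eqxx /=.
  by apply/orP; left; apply: contraNneq nij => ->.
Qed.

Lemma perm_cover_fold : k_fold perm_cover_part k.
Proof.
move=> v; have -> : perm_cover_part v = [set ((v, i) : perm_cover) | i in [set: 'I_k]].
  apply/setP => -[u i]; rewrite inE /=; apply/eqP/imsetP => [->|[j _ [-> _]] //].
  by exists i; rewrite ?inE.
by rewrite (@card_imset _ perm_cover) ?cardsT ?card_ord // => i j [].
Qed.

(** A colouring with [k] colours is injective on each list, which is a clique of size [k], so it
    restricts to a permutation [p v]. *)
Lemma packable_perm_cover : correspondence_packable G k ->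
  exists p : G -> 'S_k,
    forall u v, edge u v -> forall i, p v (s u v i) != p u i.
Proof.
move=> /(_ _ _ perm_coverP perm_cover_fold) chi.
have := colorable_chromatic_number perm_cover; rewrite chi.
case/existsP => c /forallP cP.
have {}cP x y : perm_cover_edge x y -> c x != c y.
  by move=> xy; have /forallP/(_ y)/implyP/(_ xy) := cP x.
have inj v : injective (fun i => c (v, i)).
  move=> i j eqc; apply/eqP/negPn/negP => nij.
  have := cP (v, i) (v, j); rewrite /perm_cover_edge /= eqxx nij eqc eqxx.
  by move/(_ isT).
exists (fun v => perm (inj v)) => u v uv i; rewrite !permE eq_sym.
by apply: cP; rewrite /perm_cover_edge /= uv eqxx orbT.
Qed.
End PermutationCover.

(** * Lower bounds: a single edge, and the sign obstruction on cycles *)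

Lemma packable1_edgeless (G : sgraph) (u v : G) :
  correspondence_packable G 1 -> ~~ edge u v.
Proof.
move=> /(@packable_perm_cover _ _ (fun _ _ => 1%g))[|p pP].
  by move=> *; rewrite invg1.
by apply/negP => /pP/(_ ord0)/eqP; apply; rewrite !ord1.
Qed.

Lemma odd_derangement2 (d : 'S_2) : (forall i, d i != i) -> odd_perm d.
Proof.
move=> dd; rewrite (_ : d = tperm ord0 ord_max) ?odd_tperm //.
have eq2 (a b c : 'I_2) : a != c -> b != c -> a = b.
  by case: a b c => [[|[]]] // ? [[|[]]] // ? [[|[]]] //= ? _ _; apply: val_inj.
apply/permP => i; apply: eq2 (dd i) _.
by case: tpermP => [->|->|] //; case: i => [[|[]]] //= ? /eqP + /eqP.
Qed.

(** Such a [d] is a 3-cycle, and an element of order dividing 3 has even sign. *)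
Lemma even_derangement3 (d : 'S_3) : (forall i, d i != i) -> ~~ odd_perm d.
Proof.
move=> dd; suff d3 : (d ^+ 3 = 1)%g.
  by have := congr1 (@odd_perm _) d3; rewrite !expgS expg0 !odd_permM odd_perm1; case: odd_perm.
have all3 (a b c x : 'I_3) : a != b -> a != c -> b != c -> [|| x == a, x == b | x == c].
  by case: a b c x => [[|[|[]]]] //= ? [[|[|[]]]] //= ? [[|[|[]]]] //= ? [[|[|[]]]].
have third (a b : 'I_3) : exists2 c, a != c & b != c.
  have /card_gt0P[c] : 0 < #|~: [set a; b]|.
    by rewrite cardsCs setCK card_ord subn_gt0 cards2; case: eqP.
  by rewrite !inE negb_or => /andP[*]; exists c; rewrite eq_sym.
apply/permP => i; rewrite !expgS expg0 mulg1 !permM perm1; apply/eqP.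
have ni := dd i; have ndi := dd (d i).
(* If [d] swaps [i] and [d i], the third point has no image left but itself. Otherwise [i], [d i],
   [d (d i)] are all the points, and only [i] can be the image of the last. *)
have [eqi|nddi] := eqVneq (d (d i)) i.
  have [e ie die] := third i (d i).
  have := all3 _ _ _ (d e) _ ie die; rewrite eq_sym => /(_ ni).
  rewrite (negbTE (dd e)) orbF -{1}eqi !(inj_eq perm_inj).
  by rewrite eq_sym (negbTE die) eq_sym (negbTE ie).
have := all3 i (d i) (d (d i)) (d (d (d i))).
rewrite eq_sym ni eq_sym nddi eq_sym ndi => /(_ isT isT isT).
by rewrite (negbTE (dd _)) orbF (inj_eq perm_inj) (negbTE nddi) orbF.
Qed.

(* With all matchings trivial except on the closing edge, the sign of [p v]
   changes by [e] along each edge, so the closing matching must have sign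
   [n * e]; a transposition or the identity violates this. *)
Lemma cycle_not_packable (n k : nat) (e : bool) : 2 < n -> 1 < k ->
  (forall d : 'S_k, (forall i, d i != i) -> odd_perm d = e) ->
  ~ correspondence_packable (cycle_graph n) k.
Proof.
case: n => // m; rewrite ltnS => m_gt1; case: k => [|[|k]] // _ sgn.
pose t : 'S_k.+2 := if odd m.+1 && e then 1%g else tperm ord0 ord_max.
have odd_t : odd_perm t = ~~ (odd m.+1 && e).
  by rewrite /t; case: ifP => _; rewrite ?odd_perm1 ?odd_tperm.
(* Being an involution lets [t] serve the closing edge in both directions. *)
have tV : (t^-1 = t)%g by rewrite /t; case: ifP => _; rewrite ?invg1 ?tpermV.
pose closing (u v : 'I_m.+1) := (u == ord0) && (v == ord_max).
pose s (u v : cycle_graph m.+1) : 'S_k.+2 :=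
  if closing u v || closing v u then t else 1%g.
move=> /(@packable_perm_cover _ _ s)[|p pP].
  by move=> u v; rewrite /s orbC; case: ifP => _; rewrite ?invg1 ?tV.
(* Conjugation-free form of the colouring condition: [(p u)^-1 * (s u v * p v)] is a derangement,
   hence has sign [e]. *)
have step u v : edge u v -> odd_perm (p v) = odd_perm (s u v) (+) odd_perm (p u) (+) e.
  move=> /pP neq; rewrite -(sgn ((p u)^-1 * (s u v * p v)))%g => [|i].
    by rewrite !odd_permM odd_permV; do 3!case: (odd_perm _).
  by rewrite !permM; have := neq ((p u)^-1 i)%g; rewrite permKV.
have along i : i <= m -> odd_perm (p (inord i)) = odd_perm (p ord0) (+) (odd i && e).
  elim: i => [_|i IH lti].
    by rewrite /= addbF; congr (odd_perm (p _)); apply/val_inj; rewrite /= inordK.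
  have vi : (inord i : 'I_m.+1) = i :> nat by rewrite inordK // ltnS ltnW.
  have vi1 : (inord i.+1 : 'I_m.+1) = i.+1 :> nat by rewrite inordK // ltnS.
  rewrite (step (inord i)); last first.
    rewrite /edge /= /cycle_edge -val_eqE /= vi vi1 modn_small ?ltnS // eqxx andbT.
    by rewrite neq_ltn leqnn.
  rewrite /s /closing -!val_eqE /= vi vi1 /=.
  rewrite (_ : _ || _ = false) ?odd_perm1 ?IH ?(ltnW lti) //=.
    by case: odd (odd_perm _) (e) => [] [] [].
  (* A forward edge could be the closing one only if [m = 1]. *)
  by apply/negbTE; rewrite orbF; apply/negP => /andP[/eqP-> /eqP] em; rewrite -em in m_gt1.
have := step (inord m) ord0; rewrite along //.
rewrite /edge /= /cycle_edge /s /closing -!val_eqE /= inordK // !eqxx modnn eqxx /= orbT.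
rewrite odd_t -lt0n (ltnW m_gt1) /= => /(_ isT).
by case: odd (odd_perm _) (e) => [] [] [].
Qed.

(** * Paths and cycles in their natural vertex order *)

Lemma path_packable2 (n : nat) : 0 < n -> correspondence_packable (path_graph n) 2.
Proof.
case: n => // m _.
apply: (@degenerate_packable (path_graph m.+1) ord0 (@nat_of_ord _) 1) => //.
  exact: val_inj.
move=> v; rewrite -(cards1 (inord v.-1 : 'I_m.+1)).
apply/subset_leq_card/subsetP => u; rewrite !inE => /andP[/orP[] /eqP uv ltuv].
  by rewrite -uv /= inord_val.
by move: ltuv; rewrite -uv ltnNge leqnSn.
Qed.

Lemma cycle_packable4 (n : nat) : 0 < n -> correspondence_packable (cycle_graph n) 4.
Proof.
case: n => // m _.
apply: (@degenerate_packable (cycle_graph m.+1) ord0 (@nat_of_ord _) 2) => //.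
  exact: val_inj.
move=> v; apply: (@leq_trans #|[set inord v.-1; ord0 : 'I_m.+1]|); last first.
  by rewrite cards2; case: (_ != _).
apply/subset_leq_card/subsetP => u; rewrite !inE => /andP[/andP[_ /orP[] /eqP uv] ltuv].
  by rewrite -uv modn_small /= ?inord_val ?eqxx // (leq_ltn_trans ltuv).
(* An earlier neighbour reached as the successor of [v] means wraparound: [v] is the last vertex and
   [u] is [0]. *)
apply/orP; right; rewrite -val_eqE /= -uv.
have := ltn_ord v; rewrite leq_eqVlt => /orP[/eqP->|ltv]; first by rewrite modnn.
by move: ltuv; rewrite -uv modn_small // ltnNge leqnSn.
Qed.

Theorem theorem14 :
  (forall n : nat, 2 <= n ->
     is_correspondence_packing_number (path_graph n) 2) /\
  (forall n : nat, 3 <= n ->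
     is_correspondence_packing_number (cycle_graph n) 4).
Proof.
split=> n n_ge.
  split=> // [|[|[|j]] // _ pack1]; first by apply: path_packable2; apply: ltnW.
  case: n n_ge pack1 => [|[|n]] // _.
  by move=> /(@packable1_edgeless (path_graph n.+2) (inord 0) (inord 1)); rewrite /edge /= /path_edge !inordK.
(* Three values remain to exclude: 1 by an edge, 2 and 3 by the sign of derangements. *)
split=> // [|[|[|[|[|j]]]] // _ pack]; first by apply: cycle_packable4; do 2!apply: ltnW.
- case: n n_ge pack => [|[|[|n]]] // _.
  move=> /(@packable1_edgeless (cycle_graph n.+3) (inord 0) (inord 1)).
  by rewrite /edge /= /cycle_edge -val_eqE /= !inordK.
- by case: (@cycle_not_packable n 2 true n_ge isT odd_derangement2 pack).
- by case: (@cycle_not_packable n 3 false n_ge isT (fun d dd => negbTE (even_derangement3 dd)) pack).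
Qed.
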